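(* Let $\mu>0$ and let $h$ be an intensity function with $\int_0^{\infty} h(y)\,dy =\infty$ such that $\lim_{x_e\to \infty}PoA(h, x_e)$ exists. Then: (1) if $h$ increases monotonically from some point on, then $\lim_{x_e\to \infty}PoA(h, x_e)\geq 2$; (2) if $h$ decreases monotonically from some point on, then $\lim_{x_e\to \infty}PoA(h, x_e)\leq 2$.
   Context: Fix $\mu>0$ (service rate) and $c_t>0$ (travel cost per unit distance). An intensity function is a nonnegative measurable function $h$ on $[0,\infty)$ such that $\lambda(x)=\int_0^x h(y)\,dy$ is finite for all $x\ge 0$. In the M/G/1/1 loss system, customers with distance less than $x$ from the server arrive as a Poisson process of rate $\lambda(x)$; a customer joins only if the server is idle and his distance is at most the threshold in use. The service value is $R$, the waiting cost per unit time is $c_w$, and $x_e=\frac{R\mu-c_w}{c_t\mu}>0$ is the Nash equilibrium threshold (treated as a positive parameter, with $\mu$ and $h$ fixed). The expected social benefit per unit time with threshold $x\ge 0$ is $$S(x)=\frac{c_t\int_0^x (x_e-y)h(y)\,dy}{1+\frac1\mu\int_0^x h(y)\,dy}.$$ The socially optimal threshold $x^*$ (which maximizes $S$ over $x\ge0$) is the unique $x\ge 0$ satisfying $x_e=\frac1\mu\int_0^{x}(x-y)h(y)\,dy+x$; it depends on $x_e$, $h$ and $\mu$. The price of anarchy is $$PoA(h,x_e)=\frac{S(x^* )}{S(x_e)}=\frac{\int_{0}^{x^*} (x_e-y)h(y)\,dy}{\int_{0}^{x_e} (x_e-y)h(y)\,dy}\cdot\frac{1+\frac{1}{\mu} \int_{0}^{x_e}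 h(y)\,dy}{1+\frac{1}{\mu} \int_{0}^{x^*} h(y)\,dy}$$ (defined whenever $\int_0^{x_e}h(y)\,dy>0$; $c_t$ cancels). Limits are allowed to equal $+\infty$. ''From some point on'' means on $[M,\infty)$ for some $M\ge 0$. *)

(* Defs.v *)
From HB Require Import structures.
From mathcomp Require Import all_boot all_order all_algebra.
From mathcomp Require Import all_classical all_reals all_analysis.
Import Order.TTheory GRing.Theory Num.Theory.
Import numFieldNormedType.Exports.

Set Implicit Arguments.
Unset Strict Implicit.
Unset Printing Implicit Defensive.

Local Open Scope classical_set_scope.
Local Open Scope ring_scope.

(* Only the values of [h] on [0, +oo[ matter. Throughout, [mu] is the service
   rate, [ct] the travel cost per unit distance, [xe] the Nash equilibrium
   threshold. *)

Definition intensity (R : realType) (h : R -> R) : Prop :=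
  [/\ measurable_fun `[(0 : R), +oo[ h,
      (forall y : R, 0 <= y -> 0 <= h y) &
      (forall x : R, 0 <= x ->
        (\int[lebesgue_measure]_(y in `[0%R, x]) (h y)%:E < +oo)%E)].

Definition infinite_mass (R : realType) (h : R -> R) : Prop :=
  (\int[lebesgue_measure]_(y in `[(0%R : R), +oo[) (h y)%:E = +oo)%E.

Definition social_benefit (R : realType) (mu ct : R) (h : R -> R)
    (xe x : R) : R :=
  (ct * \int[lebesgue_measure]_(y in `[0, x]) ((xe - y) * h y)) /
  (1 + mu^-1 * \int[lebesgue_measure]_(y in `[0, x]) h y).

Definition optimality_eq (R : realType) (mu : R) (h : R -> R)
    (xe x : R) : Prop :=
  0 <= x /\
  xe = mu^-1 * (\int[lebesgue_measure]_(y in `[0, x]) ((x - y) * h y)) + x.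

(* For [0 < mu], [0 < xe] and an intensity [h], the equation has exactly one
   solution (its right-hand side is continuous, strictly increasing, vanishes
   at 0 and is at least [x]), so the default value 0 is never used. *)
Definition opt_threshold (R : realType) (mu : R) (h : R -> R) (xe : R) : R :=
  xget 0 [set x | optimality_eq mu h xe x].

(* The quotient is meaningful when the integral of [h] over [0, xe] is positive;
   when [infinite_mass h] holds, this is the case for all large [xe], so the
   convention [x / 0 = 0] does not affect limits at +oo. The value does not depend on
   [ct] as long as [0 < ct]. *)
Definition PoA (R : realType) (mu ct : R) (h : R -> R) (xe : R) : R :=
  social_benefit mu ct h xe (opt_threshold mu h xe) /
  social_benefit mu ct h xe xe.

Definition eventually_nondecreasing (R : realType) (h : R -> R) : Prop :=
  exists2 M : R, 0 <= M & {in `[M, +oo[ &, {homo h : x y / x <= y}}.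

Definition eventually_nonincreasing (R : realType) (h : R -> R) : Prop :=
  exists2 M : R, 0 <= M & {in `[M, +oo[ &, {homo h : x y /~ x <= y}}.

(* Main.v *)
(* Write L = [mass h] and G = [moment h]. The optimality equation says
   G(x* ) = mu (xe - x* ), which turns the price of anarchy into
   (xe - x* ) (mu + L xe) / G xe. If h is monotone on [M, xe], comparing it with
   its value at the midpoint (Chebyshev's sum inequality) bounds G xe by about
   xe * L xe / 2, from above when h increases and from below when h decreases.
   As L tends to +oo, the terms mu and L M are negligible; the upper bound on
   the price of anarchy then only needs x* >= 0, and the lower bound needs
   x* = o(xe), which follows from G x >= (x - a) L a with L a large. *)
Require Import Defs.
From mathcomp Require Import all_boot all_order all_algebra.
From mathcomp Require Import all_classical all_reals all_analysis.
From mathcomp Require Import measurable_realfun ring lra.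
Import Order.TTheory GRing.Theory Num.Theory.
Import numFieldNormedType.Exports.

Local Open Scope classical_set_scope.
Local Open Scope ring_scope.

(** * Integrals against affine weights on compact intervals *)

Definition mass (R : realType) (h : R -> R) (x : R) : R :=
  \int[lebesgue_measure]_(y in `[0, x]) h y.

(** This is the integral in the optimality equation; at [x = xe] it is also, up to the factor [ct],
    the numerator of the social benefit at the equilibrium threshold. *)
Definition moment (R : realType) (h : R -> R) (x : R) : R :=
  \int[lebesgue_measure]_(y in `[0, x]) ((x - y) * h y).

Lemma affine_bounded (R : realType) (c a b : R) :
  [bounded c - y | y in `[a, b]%classic].
Proof.
exists (`|c| + `|a| + `|b|); split=> [|N ltN y /=]; first exact: num_real.
rewrite in_itv /= => /andP[ay yb].
have := ler_norm c; have := ler_norm a; have := ler_norm b.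
have := ler_norm (- c); have := ler_norm (- a); have := ler_norm (- b).
rewrite !normrN => *; rewrite ler_norml; apply/andP; split; lra.
Qed.

Lemma integrable_affine_mul (R : realType) (f : R -> R) (c a b : R) :
  lebesgue_measure.-integrable `[a, b] (EFin \o f) ->
  lebesgue_measure.-integrable `[a, b] (EFin \o (fun y => (c - y) * f y)).
Proof.
move=> intf.
have mc : measurable_fun (`[a, b] : set (measurableTypeR R)) (fun y => c - y).
  by apply: measurable_funB => //; exact: measurable_id.
have : lebesgue_measure.-integrable `[a, b]
    ((EFin \o (fun y => (c - y)%R)) \* (EFin \o f))%E.
  by apply: integrableMr => //; exact: affine_bounded.
exact.
Qed.

Lemma integrable_mull (R : realType) (f : R -> R) (c a b : R) :
  lebesgue_measure.-integrable `[a, b] (EFin \o f) ->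
  lebesgue_measure.-integrable `[a, b] (EFin \o (fun y => c * f y)).
Proof.
move=> intf.
have : lebesgue_measure.-integrable `[a, b] (fun y => c%:E * (EFin \o f) y)%E.
  by apply: integrableZl.
exact.
Qed.

Lemma integrable_affine (R : realType) (c a b : R) :
  lebesgue_measure.-integrable `[a, b] (EFin \o (fun y : R => c - y)).
Proof.
apply: measurable_bounded_integrable => //.
- by rewrite /= lebesgue_measure_itv /=; case: ifP => // _; rewrite -EFinB ltry.
- by apply: measurable_funB => //; exact: measurable_id.
- exact: affine_bounded.
Qed.

Lemma Rintegral_itv_split (R : realType) (f : R -> R) (a c b : R) :
  a <= c -> c <= b ->
  lebesgue_measure.-integrable `[a, b] (EFin \o f) ->
  \int[lebesgue_measure]_(y in `[a, b]) f y =
  \int[lebesgue_measure]_(y in `[a, c]) f y +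
  \int[lebesgue_measure]_(y in `[c, b]) f y.
Proof.
move=> ac cb intf; rewrite -(Rintegral_itv_obnd_cbnd (r := c)); last first.
  by apply: integrableS intf => //; apply: subset_itvr; rewrite bnd_simp.
by rewrite -(Rintegral_itvB intf (x := c)) ?bnd_simp// addrC subrK.
Qed.

(** The integrand is odd about the midpoint. This makes the comparison term in Chebyshev's
    inequality vanish. *)
Lemma Rintegral_midpoint_affine (R : realType) (a b : R) : a < b ->
  \int[lebesgue_measure]_(y in `[a, b]) ((a + b) / 2 - y) = 0.
Proof.
move=> ab; set m := (a + b) / 2.
pose F := fun y : R => m * y - y ^+ 2 / 2.
have dF (y : R) : is_derive y 1 F (m - y).
  by apply: is_derive_eq; rewrite /GRing.scale /=; field.
have cF (y : R) : F @ y --> F y.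
  by apply: differentiable_continuous; exact/derivable1_diffP/ex_derive.
rewrite /Rintegral (@continuous_FTC2 _ (fun y => m - y) F)//.
- by rewrite -EFinB /= /F /m; field.
- apply: continuous_subspaceT => y; apply: cvgB; [exact: cvg_cst|exact: cvg_id].
- split.
  + by move=> y _; apply: ex_derive.
  + exact/cvg_at_right_filter/cF.
  + exact/cvg_at_left_filter/cF.
- by move=> y _; rewrite derive1E; exact: derive_val.
Qed.

(** * Integrability and mass of an intensity *)

Lemma intensity_integrable (R : realType) (h : R -> R) (a b : R) :
  intensity h -> 0 <= a ->
  lebesgue_measure.-integrable `[a, b] (EFin \o h).
Proof.
move=> [mh h0 hfin] a0; have [b0|b0] := ltP b 0.
  by rewrite set_itv_ge ?bnd_simp -?ltNge ?(lt_le_trans b0)//; exact: integrable_set0.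
have sub : `[0, b]%classic `<=` (`[0, +oo[%classic : set R).
  by apply: subset_itvl.
suff : lebesgue_measure.-integrable `[0, b] (EFin \o h).
  apply: integrableS => //; exact: subset_itvr.
apply/integrableP; split.
  by apply/measurable_EFinP; exact: measurable_funS mh.
under eq_integral => y.
  rewrite inE /= in_itv /= => /andP[y0 _].
  rewrite ger0_norm ?h0//; over.
exact: hfin.
Qed.

Lemma mass_split (R : realType) (h : R -> R) (a b : R) :
  intensity h -> 0 <= a -> a <= b ->
  mass R h b = mass R h a + \int[lebesgue_measure]_(y in `[a, b]) h y.
Proof.
by move=> hh a0 ab; apply: Rintegral_itv_split => //; exact: intensity_integrable.
Qed.

Lemma Rintegral_intensity_ge0 (R : realType) (h : R -> R) (a b : R) :
  intensity h -> 0 <= a -> 0 <= \int[lebesgue_measure]_(y in `[a, b]) h y.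
Proof.
move=> [_ h0 _] a0; apply: Rintegral_ge0 => y /=.
by rewrite in_itv /= => /andP[ay _]; rewrite h0 ?(le_trans a0).
Qed.

Lemma mass_ge0 (R : realType) (h : R -> R) (a : R) :
  intensity h -> 0 <= mass R h a.
Proof. by move=> hh; exact: Rintegral_intensity_ge0. Qed.

Lemma le_mass (R : realType) (h : R -> R) (a b : R) :
  intensity h -> 0 <= a -> a <= b -> mass R h a <= mass R h b.
Proof.
move=> hh a0 ab; rewrite (mass_split R h a b)// lerDl.
exact: Rintegral_intensity_ge0.
Qed.

(** The integral over the half-line is the supremum of those over compact intervals with integer
    right endpoint, so a bound [K] on all masses would make it finite. *)
Lemma mass_unbounded (R : realType) (h : R -> R) (K : R) :
  intensity h -> infinite_mass h -> exists2 a : R, 0 <= a & K < mass R h a.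
Proof.
move=> hh hinf; have [mh h0 hfin] := hh.
(* Nothing is known about [h] at negative arguments; its extension by zero is nonnegative and
   measurable on the whole line. *)
pose f : R -> R := h \_ `[0, +oo[.
have f0 y : 0 <= f y.
  rewrite /f /patch; case: ifPn => //; rewrite inE /= in_itv /= andbT; exact: h0.
have mf : measurable_fun setT f.
  exact: (measurable_restrictT h (measurable_itv _)).1 mh.
have fE y : 0 <= y -> f y = h y.
  by move=> y0; rewrite /f patchE mem_set//= in_itv /= andbT.
apply: contrapT => Kmass.
suff : (\int[lebesgue_measure]_(y in `[0%R, +oo[) (f y)%:E <= K%:E)%E.
  under eq_integral => y.
    rewrite inE /= in_itv /= andbT => y0; rewrite fE//; over.
  by rewrite hinf.
rewrite ge0_integral_ereal_sup//; apply: ge_ereal_sup => _ [n _ <-].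
under eq_integral => y.
  rewrite inE /= in_itv /= => /andP[y0 _]; rewrite fE//; over.
rewrite -[leLHS]fineK; last first.
  by apply: integrable_fin_num => //; exact: intensity_integrable.
rewrite lee_fin leNgt; apply/negP => Kn; apply: Kmass.
by exists n.+1%:R.
Qed.

(** * Recentering, splitting and bounding the moment *)

Lemma Rintegral_affine_mul (R : realType) (f : R -> R) (c a b : R) :
  lebesgue_measure.-integrable `[a, b] (EFin \o f) ->
  \int[lebesgue_measure]_(y in `[a, b]) ((c - y) * f y) =
  c * \int[lebesgue_measure]_(y in `[a, b]) f y +
  \int[lebesgue_measure]_(y in `[a, b]) ((0 - y) * f y).
Proof.
move=> intf; rewrite -RintegralZl// -RintegralD//.
- by apply: eq_Rintegral => y _; ring.
- exact: integrable_mull.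
- exact: integrable_affine_mul.
Qed.

(** Recentering of the weight from [c] to [d]; it serves for splitting the moment, for passing from
    [xe] to the optimal threshold, and for passing from an endpoint to the midpoint. *)
Lemma Rintegral_affine_mul_shift (R : realType) (f : R -> R) (c d a b : R) :
  lebesgue_measure.-integrable `[a, b] (EFin \o f) ->
  \int[lebesgue_measure]_(y in `[a, b]) ((c - y) * f y) =
  (c - d) * \int[lebesgue_measure]_(y in `[a, b]) f y +
  \int[lebesgue_measure]_(y in `[a, b]) ((d - y) * f y).
Proof.
move=> intf; rewrite Rintegral_affine_mul// [in RHS]Rintegral_affine_mul//; ring.
Qed.

Lemma moment_split (R : realType) (h : R -> R) (a b : R) :
  intensity h -> 0 <= a -> a <= b ->
  moment R h b = moment R h a + (b - a) * mass R h a
               + \int[lebesgue_measure]_(y in `[a, b]) ((b - y) * h y).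
Proof.
move=> hh a0 ab; rewrite /moment (Rintegral_itv_split _ _ _ _ _ a0 ab)//; last first.
  by apply: integrable_affine_mul; exact: intensity_integrable.
rewrite (Rintegral_affine_mul_shift _ _ b a 0 a); last exact: intensity_integrable.
by rewrite (addrC ((b - a) * _)).
Qed.

Lemma Rintegral_moment_ge0 (R : realType) (h : R -> R) (a b : R) :
  intensity h -> 0 <= a ->
  0 <= \int[lebesgue_measure]_(y in `[a, b]) ((b - y) * h y).
Proof.
move=> [_ h0 _] a0; apply: Rintegral_ge0 => y /=.
rewrite in_itv /= => /andP[ay yb].
by rewrite mulr_ge0 ?subr_ge0// h0 ?(le_trans a0).
Qed.

Lemma moment_ge0 (R : realType) (h : R -> R) (a : R) :
  intensity h -> 0 <= moment R h a.
Proof. by move=> hh; exact: Rintegral_moment_ge0. Qed.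

(** All mass in [[0, a]] lies at distance at least [b - a] from [b]. *)
Lemma moment_ge (R : realType) (h : R -> R) (a b : R) :
  intensity h -> 0 <= a -> a <= b -> (b - a) * mass R h a <= moment R h b.
Proof.
move=> hh a0 ab; rewrite (moment_split _ _ a b)//.
have := moment_ge0 R h a hh; have := Rintegral_moment_ge0 R h a b hh a0; lra.
Qed.

Lemma moment_le (R : realType) (h : R -> R) (a : R) :
  intensity h -> 0 <= a -> moment R h a <= a * mass R h a.
Proof.
move=> hh a0; rewrite /moment Rintegral_affine_mul; last exact: intensity_integrable.
rewrite gerDl -oppr_ge0 -mulN1r -RintegralZl//; last first.
  by apply: integrable_affine_mul; exact: intensity_integrable.
have [_ h0 _] := hh; apply: Rintegral_ge0 => y /=; rewrite in_itv /= => /andP[y0 _].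
by rewrite (_ : _ * _ = y * h y) ?mulr_ge0 ?h0//; ring.
Qed.

(** * The optimal threshold and a closed form of the price of anarchy *)

Lemma within_continuous_id (R : realType) (A : set R) :
  {within A, continuous (@id R)}.
Proof. by apply: continuous_subspaceT => y; exact: cvg_id. Qed.

Lemma moment_continuous (R : realType) (h : R -> R) (b : R) :
  intensity h -> 0 <= b -> {within `[0, b], continuous (moment R h)}.
Proof.
move=> hh b0.
have inth := intensity_integrable R h 0 b hh (lexx 0).
have cmass := parameterized_integral_continuous b0 inth.
have cmom := parameterized_integral_continuous b0 (integrable_affine_mul R h 0 0 b inth).
(* The variable [x] occurs in the domain and in the integrand; pulling it out of the integrand
   leaves integrals that depend on [x] only through their upper endpoint. *)
rewrite (_ : moment R h = fun x => x * mass R h x +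
  parameterized_integral lebesgue_measure 0 x (fun y => (0 - y) * h y)); last first.
  apply/funext => x; apply: Rintegral_affine_mul; exact: intensity_integrable.
move=> x; apply: cvgD; last exact: cmom.
apply: cvgM; last exact: cmass.
exact: (within_continuous_id R).
Qed.

Lemma opt_threshold_spec (R : realType) (mu : R) (h : R -> R) (xe : R) :
  0 < mu -> intensity h -> 0 <= xe ->
  0 <= opt_threshold mu h xe /\
  moment R h (opt_threshold mu h xe) = mu * (xe - opt_threshold mu h xe).
Proof.
move=> mu0 hh xe0; set x := opt_threshold mu h xe.
suff [x0 xeE] : optimality_eq mu h xe x.
  split=> //; rewrite {1}xeE -/(moment R h x).
  by rewrite addrK mulrA divff ?mul1r ?gt_eqF.
(* Existence of a solution suffices. The right-hand side [f] of the equation is continuous with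
   [f 0 = 0] and [xe <= f xe], so the intermediate value theorem gives one. *)
apply: xgetPex; pose f y := mu^-1 * moment R h y + y.
have cf : {within `[0, xe], continuous f}.
  move=> y; apply: cvgD.
    by apply: cvgM; [exact: cvg_cst|exact: moment_continuous].
  exact: (within_continuous_id R).
have f0 : f 0 = 0.
  by rewrite /f /moment set_itv1 Rintegral_set1 mulr0 addr0.
have fxe : xe <= f xe.
  by rewrite /f lerDr mulr_ge0 ?moment_ge0 ?invr_ge0 ?ltW.
have [|y] := IVT xe0 cf (v := xe).
  by rewrite f0 min_l ?max_r ?(le_trans xe0)// xe0.
by rewrite in_itv /= => /andP[y0 _] <-; exists y.
Qed.

(** At the optimum [x], recentering from [xe] to [x] and the optimality equation turn the numerator
    of the benefit into [ct * (xe - x) * (mass x + mu)]; its second factor cancels against the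
    denominator, leaving [ct * mu * (xe - x)]. *)
Lemma PoA_moment (R : realType) (mu ct : R) (h : R -> R) (xe : R) :
  0 < mu -> 0 < ct -> intensity h -> 0 <= xe ->
  PoA mu ct h xe =
  (xe - opt_threshold mu h xe) * (mu + mass R h xe) / moment R h xe.
Proof.
move=> mu0 ct0 hh xe0; have [x0 momx] := opt_threshold_spec R mu h xe mu0 hh xe0.
rewrite /PoA; move: (opt_threshold _ _ _) x0 momx => x x0 momx.
rewrite /social_benefit -/(mass R h x) -/(mass R h xe) -/(moment R h xe).
rewrite (Rintegral_affine_mul_shift _ _ xe x); last exact: intensity_integrable.
rewrite -/(mass R h x) -/(moment R h x) momx.
have := mass_ge0 R h x hh; have := mass_ge0 R h xe hh.
move: (mass R h x) (mass R h xe) => l m m0 l0.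
(* For zero moment both sides are 0 by the convention on division by zero. *)
have [->|G0] := eqVneq (moment R h xe) 0; first by rewrite mulr0 mul0r !invr0 !mulr0.
field; rewrite G0 !gt_eqF//; lra.
Qed.

(** * Chebyshev's inequality for monotone functions *)

(** With [m] the midpoint, [(m - y) * (f y - f m) <= 0] for every [y], because the two factors have
    opposite signs; the weight [m - y] integrates to 0, so replacing [f y] by [f m] leaves
    nothing. *)
Lemma nondecreasing_Chebyshev (R : realType) (f : R -> R) (a b : R) :
  a < b -> lebesgue_measure.-integrable `[a, b] (EFin \o f) ->
  {in `[a, b] &, {homo f : x y / x <= y}} ->
  \int[lebesgue_measure]_(y in `[a, b]) ((b - y) * f y) <=
  (b - a) / 2 * \int[lebesgue_measure]_(y in `[a, b]) f y.
Proof.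
move=> ab intf fmono.
rewrite (Rintegral_affine_mul_shift _ _ b ((a + b) / 2))//.
have -> : b - (a + b) / 2 = (b - a) / 2 by field.
rewrite gerDl -(mulr0 (f ((a + b) / 2))) -(Rintegral_midpoint_affine _ _ _ ab).
rewrite -RintegralZl//; last exact: integrable_affine.
apply: le_Rintegral => //.
- exact: integrable_affine_mul.
- exact/integrable_mull/integrable_affine.
move=> y /=; rewrite in_itv /= => /andP[ay yb].
rewrite mulrC; have [ym|my] := leP y ((a + b) / 2).
  by apply: ler_wpM2r; [lra|apply: fmono => //; rewrite in_itv /=; lra].
apply: ler_wnM2r; first lra.
by apply: fmono; rewrite ?in_itv /=; lra.
Qed.

Lemma nonincreasing_Chebyshev (R : realType) (f : R -> R) (a b : R) :
  a < b -> lebesgue_measure.-integrable `[a, b] (EFin \o f) ->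
  {in `[a, b] &, {homo f : x y /~ x <= y}} ->
  (b - a) / 2 * \int[lebesgue_measure]_(y in `[a, b]) f y <=
  \int[lebesgue_measure]_(y in `[a, b]) ((b - y) * f y).
Proof.
move=> ab intf fmono.
rewrite (Rintegral_affine_mul_shift _ _ b ((a + b) / 2))//.
have -> : b - (a + b) / 2 = (b - a) / 2 by field.
rewrite lerDl -(mulr0 (f ((a + b) / 2))) -(Rintegral_midpoint_affine _ _ _ ab).
rewrite -RintegralZl//; last exact: integrable_affine.
apply: le_Rintegral => //.
- exact/integrable_mull/integrable_affine.
- exact: integrable_affine_mul.
move=> y /=; rewrite in_itv /= => /andP[ay yb].
rewrite [leRHS]mulrC; have [ym|my] := leP y ((a + b) / 2).
  by apply: ler_wpM2r; [lra|apply: fmono => //; rewrite in_itv /=; lra].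
apply: ler_wnM2r; first lra.
by apply: fmono; rewrite ?in_itv /=; lra.
Qed.

(** * Bounds for large [xe] and passage to the limit *)

Lemma near_mass_ge (R : realType) (h : R -> R) (K : R) :
  intensity h -> infinite_mass h -> \forall x \near +oo, K <= mass R h x.
Proof.
move=> hh hinf; have [a a0 Ka] := mass_unbounded R h K hh hinf.
near=> x; apply: le_trans (ltW Ka) _; exact: le_mass.
Unshelve. all: by end_near. Qed.

(** If the optimum [x] exceeded [d * xe], then [a <= d * xe / 2] would give [x - a > d * xe / 2], so
    the moment at [x] would exceed [(d * xe / 2) * (2 * mu / d) = mu * xe], against its value
    [mu * (xe - x)]. *)
Lemma near_opt_threshold_le (R : realType) (mu : R) (h : R -> R) (d : R) :
  0 < mu -> intensity h -> infinite_mass h -> 0 < d ->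
  \forall xe \near +oo, opt_threshold mu h xe <= d * xe.
Proof.
move=> mu0 hh hinf d0.
have [a a0 Ka] := mass_unbounded R h (2 * mu / d) hh hinf.
near=> xe.
have xe0 : 0 < xe by near: xe; apply: nbhs_pinfty_gt; exact: num_real.
have axe : 2 * a / d <= xe by near: xe; apply: nbhs_pinfty_ge; exact: num_real.
have [x0 momx] := opt_threshold_spec R mu h xe mu0 hh (ltW xe0).
move: (opt_threshold _ _ _) x0 momx => x x0 momx.
rewrite leNgt; apply/negP => dx.
move: axe; rewrite ler_pdivrMr// => axe.
have ax : a <= x by lra.
have := moment_ge R h a x hh a0 ax; rewrite momx.
move: Ka; rewrite ltr_pdivrMr//.
move: (mass R h a) => l Ka le.
have : 0 < l by nra.
nra.
Unshelve. all: by end_near. Qed.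

(** The numerator is at least [(1 - d) * xe * l] and the moment at most [(1 + d) * xe * l / 2],
    where [l] is the mass at [xe]; the choice of [d] gives [2 * (1 - d) / (1 + d) >= 2 - 4 * d >= 2
    - e]. *)
Lemma near_PoA_ge (R : realType) (mu ct : R) (h : R -> R) (e : R) :
  0 < mu -> 0 < ct -> intensity h -> infinite_mass h ->
  eventually_nondecreasing h -> 0 < e ->
  \forall xe \near +oo, 2 - e <= PoA mu ct h xe.
Proof.
move=> mu0 ct0 hh hinf [M M0 hmono] e0.
pose d := Num.min (e / 4) 1.
have d0 : 0 < d by rewrite lt_min; apply/andP; split; lra.
have d1 : d <= 1 by rewrite ge_min lexx orbT.
have de : 4 * d <= e by rewrite -ler_pdivlMl ?ge_min 1?mulrC ?lexx.
(* Positive mass on some [[0, a]] makes the moment at [xe > a] positive, so the quotient can be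
   cleared. *)
have [a a0 la] := mass_unbounded R h 0 hh hinf.
near=> xe.
have xeM : M < xe by near: xe; apply: nbhs_pinfty_gt; exact: num_real.
have xea : a < xe by near: xe; apply: nbhs_pinfty_gt; exact: num_real.
have xe0 : 0 < xe by lra.
have xd : opt_threshold mu h xe <= d * xe.
  by near: xe; exact: near_opt_threshold_le.
have lM : mass R h M / d <= mass R h xe by near: xe; exact: near_mass_ge.
have lM0 := mass_ge0 R h M hh.
have xxe : opt_threshold mu h xe <= xe.
  have [_ momx] := opt_threshold_spec R mu h xe mu0 hh (ltW xe0).
  by rewrite -subr_ge0 -(pmulr_rge0 _ mu0) -momx moment_ge0.
have l0 : 0 < mass R h xe.
  by apply: lt_le_trans la _; apply: le_mass => //; exact: ltW.
have G0 : 0 < moment R h xe.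
  apply: lt_le_trans (moment_ge R h a xe hh a0 (ltW xea)).
  by rewrite mulr_gt0// subr_gt0.
have GM := moment_le R h M hh M0.
have ml := le_mass R h M xe hh M0 (ltW xeM).
have inth := intensity_integrable R h M xe hh M0.
have sM : {subset `[M, xe] <= `[M, +oo[}.
  by move=> y; rewrite !in_itv /= => /andP[-> _].
have hmonoM := sub_in2 sM hmono.
have := nondecreasing_Chebyshev R h M xe xeM inth hmonoM.
have := mass_split R h M xe hh M0 (ltW xeM).
have := moment_split R h M xe hh M0 (ltW xeM).
move: lM; rewrite (PoA_moment R mu ct h xe mu0 ct0 hh (ltW xe0)).
rewrite ler_pdivlMr// ler_pdivrMr//.
move: (opt_threshold _ _ _) (mass R h xe) (mass R h M) (moment R h xe)
  (moment R h M) (\int[_]_(_ in _) _) (\int[_]_(_ in _) _) xd xxe lM0 l0 G0 GM ml.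
move=> x l m G g I J xd xxe lM0 l0 G0 GM ml lM GE lE JI.
have mdl : m <= d * l by rewrite mulrC.
have G_le : 2 * G <= (1 + d) * (xe * l).
  (* Chebyshev's bound on [[M, xe]] combines with the crude bound [g <= M * m] on [[0, M]]. *)
  have : 2 * G <= xe * m + xe * l by nra.
  nra.
have xl : 0 < xe * l by rewrite mulr_gt0.
have num_ge : (1 - d) * (xe * l) <= (xe - x) * (mu + l).
  have : (1 - d) * xe * l <= (xe - x) * l.
    by rewrite (ler_wpM2r (ltW l0))//; lra.
  have : 0 <= (xe - x) * mu by rewrite mulr_ge0 ?subr_ge0 ?(ltW mu0).
  lra.
apply: le_trans num_ge.
have : (2 - e) * G <= (2 - 4 * d) * G by rewrite (ler_wpM2r (ltW G0))//; lra.
move=> /le_trans; apply.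
(* Multiplying the bound on [G] by [2 - 4 * d] requires its sign; if it is nonpositive, so is the
   left-hand side. *)
have [d2|d2] := leP (2 - 4 * d) 0; first nra.
have : (2 - 4 * d) * (2 * G) <= (2 - 4 * d) * ((1 + d) * (xe * l)).
  by rewrite ler_wpM2l// ltW.
nra.
Unshelve. all: by end_near. Qed.

(** Neglecting [mu] against the mass and [M] against [xe] costs a factor [1 + d] each; [d <= 1] and
    [6 * d <= e] give [(1 + d) * (1 + d) <= 1 + 3 * d <= 1 + e / 2]. *)
Lemma near_PoA_le (R : realType) (mu ct : R) (h : R -> R) (e : R) :
  0 < mu -> 0 < ct -> intensity h -> infinite_mass h ->
  eventually_nonincreasing h -> 0 < e ->
  \forall xe \near +oo, PoA mu ct h xe <= 2 + e.
Proof.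
move=> mu0 ct0 hh hinf [M M0 hmono] e0.
pose d := Num.min (e / 6) 1.
have d0 : 0 < d by rewrite lt_min; apply/andP; split; lra.
have d1 : d <= 1 by rewrite ge_min lexx orbT.
have de : 6 * d <= e by rewrite -ler_pdivlMl ?ge_min 1?mulrC ?lexx.
near=> xe.
have xeM : M < xe by near: xe; apply: nbhs_pinfty_gt; exact: num_real.
(* This is equivalent to [xe <= (1 + d) * (xe - M)]. *)
have Mxe : M * (1 + d) / d <= xe by near: xe; apply: nbhs_pinfty_ge; exact: num_real.
have xe0 : 0 < xe by lra.
have lmu : mu / d <= mass R h xe by near: xe; exact: near_mass_ge.
have lM0 := mass_ge0 R h M hh.
have GM0 := moment_ge0 R h M hh.
have [x0 _] := opt_threshold_spec R mu h xe mu0 hh (ltW xe0).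
have inth := intensity_integrable R h M xe hh M0.
have sM : {subset `[M, xe] <= `[M, +oo[}.
  by move=> y; rewrite !in_itv /= => /andP[-> _].
have hmonoM := sub_in2 sM hmono.
have := nonincreasing_Chebyshev R h M xe xeM inth hmonoM.
have := mass_split R h M xe hh M0 (ltW xeM).
have := moment_split R h M xe hh M0 (ltW xeM).
move: lmu Mxe; rewrite (PoA_moment R mu ct h xe mu0 ct0 hh (ltW xe0)).
rewrite !(ler_pdivrMr _ _ d0).
move: (opt_threshold _ _ _) (mass R h xe) (mass R h M) (moment R h xe)
  (moment R h M) (\int[_]_(_ in _) _) (\int[_]_(_ in _) _) x0 lM0 GM0.
move=> x l m G g I J x0 lM0 GM0 lmu Mxe GE lE JI.
have l0 : 0 < l by nra.
have G_ge : (xe - M) * l <= 2 * G.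
  have : 0 <= (xe - M) * m by rewrite mulr_ge0// subr_ge0 ltW.
  nra.
have Ml : 0 < (xe - M) * l by rewrite mulr_gt0// subr_gt0.
have G0 : 0 < G by lra.
rewrite ler_pdivrMr//.
have num_le : (xe - x) * (mu + l) <= (1 + d) * (xe * l).
  have : (xe - x) * (mu + l) <= xe * (mu + l) by rewrite ler_wpM2r; lra.
  have : xe * mu <= xe * (l * d) by rewrite (ler_wpM2l (ltW xe0)).
  lra.
have xel : xe * l <= (1 + d) * ((xe - M) * l).
  have : xe * l <= (1 + d) * (xe - M) * l.
    by rewrite (ler_wpM2r (ltW l0))//; lra.
  lra.
have d3 : (1 + d) * (1 + d) <= 1 + e / 2 by nra.
have := ler_wpM2r (ltW Ml) d3.
have : (1 + d) * (xe * l) <= (1 + d) * ((1 + d) * ((xe - M) * l)).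
  by rewrite ler_wpM2l//; lra.
have : (1 + e / 2) * ((xe - M) * l) <= (1 + e / 2) * (2 * G).
  by rewrite ler_wpM2l//; lra.
lra.
Unshelve. all: by end_near. Qed.

Theorem theorem3p14 (R : realType) (mu ct : R) (h : R -> R)
    (mu_gt0 : 0 < mu) (ct_gt0 : 0 < ct)
    (h_intensity : intensity h) (h_infinite : infinite_mass h)
    (PoA_cvg : cvg ((PoA mu ct h xe)%:E @[xe --> +oo%R])) :
  (eventually_nondecreasing h ->
    (2%:E <= lim ((PoA mu ct h xe)%:E @[xe --> +oo%R]))%E) /\
  (eventually_nonincreasing h ->
    (lim ((PoA mu ct h xe)%:E @[xe --> +oo%R]) <= 2%:E)%E).
Proof.
(* The limit is taken in the extended reals, so an infinite limit is covered; a slack [e] reduces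
   both claims to the eventual bounds. *)
split=> hmono; apply/lee_addgt0Pr => e e0.
  rewrite -leeBlDr//; apply: lime_ge => //; near=> xe.
  by rewrite -EFinB lee_fin; near: xe; exact: near_PoA_ge.
apply: lime_le => //; near=> xe.
by rewrite -EFinD lee_fin; near: xe; exact: near_PoA_le.
Unshelve. all: by end_near. Qed.
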